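(* Let $X$ be a locally convex Hausdorff topological vector space, $g:X\to\overline{\mathbb R}$ a lower semicontinuous, proper, convex function, $h:X\to\overline{\mathbb R}$ a proper generalized polyhedral convex function, and $C\subset X$ a nonempty closed convex set with $(\mathrm{dom}\,g)\cap C\ne\emptyset$. Put $f:=g-h$. Let $H$ be a selection of $\partial h$ on $C\cap\mathrm{dom}\,\partial h$ whose value $H(x)$ depends only on the set $\partial h(x)$ (constructed as described in the context), and let $G_C$ be an arbitrary selection of $\partial(g+\delta_C)^*$ on $\mathrm{dom}\,\partial(g+\delta_C)^*$. Let $\{x^k\}_{k\in\mathbb N}$ and $\{\xi^k\}_{k\in\mathbb N}$ be (infinite) sequences constructed by DCA scheme 1, i.e. $x^0\in(\mathrm{dom}\,g)\cap C$ and, for every $k\ge0$, $x^k\in C\cap\mathrm{dom}\,\partial h$, $\xi^k=H(x^k)\in\mathrm{dom}\,\partial(g+\delta_C)^*$ and $x^{k+1}=G_C(\xi^k)$. Then there exist $\bar k\in\mathbb N$ and an integer $p\ge1$ such that: (a) from the index $\bar k$, both sequences $\{x^k\}$ and $\{\xi^k\}$ are cyclic with the period $p$, i.e. $x^{k+p}=x^k$ and $\xi^{k+p}=\xi^k$ for every $k\ge\bar k$; (b) from the index $\bar k$, the value of the objective function is constant, i.e. $f(x^k)=f(x^{\bar k})$ for every $k\ge\bar k$.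
   Context: $\mathbb N$ is the set of nonnegative integers; $\overline{\mathbb R}=\mathbb R\cup\{\pm\infty\}$, with the convention $(+\infty)-(+\infty)=+\infty$. $X^*$ is the topological dual of $X$ with the weak$^*$ topology, so that its dual is $X$. $\mathrm{dom}\,\varphi=\{x\mid\varphi(x)<+\infty\}$, $\mathrm{epi}\,\varphi=\{(x,\alpha)\in X\times\mathbb R\mid x\in\mathrm{dom}\,\varphi,\ \varphi(x)\le\alpha\}$; $\varphi$ is proper if $\mathrm{dom}\,\varphi\ne\emptyset$ and $\varphi>-\infty$ everywhere. $\delta_C$ is the indicator function of $C$ ($0$ on $C$, $+\infty$ off $C$). A subset of a locally convex Hausdorff topological vector space $Z$ is generalized polyhedral convex if it has the form $\{z\in L\mid\langle z_k^*,z\rangle\le\alpha_k,\ k=1,\dots,p\}$ with $L\subset Z$ a closed affine subspace, $z_k^*\in Z^*$, $\alpha_k\in\mathbb R$. A function is generalized polyhedral convex if its epigraph is a generalized polyhedral convex set in $X\times\mathbb R$. For a proper convex $\varphi$ and $\bar x\in\mathrm{dom}\,\varphi$, $\partial\varphi(\bar x)=\{x^*\in X^*\mid\langle x^*,x-\bar x\rangle\le\varphi(x)-\varphi(\bar x)\ \forall x\in X\}$, and $\mathrm{dom}\,\partial\varphi=\{x\mid\partial\varphi(x)\ne\emptyset\}$; the same notation is used for functions on $X^*$, with subgradients in $X$. The conjugate of $\varphi:X\to\overline{\mathbb R}$ is $\varphi^*(x^* )=\sup_{x\in X}[\langle x^*,x\rangle-\varphi(x)]$, $x^*\in X^*$.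 Construction of $H$: it is known that, for $h$ proper generalized polyhedral convex, there are finitely many nonempty generalized polyhedral convex sets $P_1,\dots,P_r\subset X^*$ such that for every $x\in\mathrm{dom}\,h$ there is a unique index $\ell\in\{1,\dots,r\}$ with $\partial h(x)=P_\ell$. One picks one element $\eta^\ell\in P_\ell$ for each $\ell$, and defines $H:C\cap\mathrm{dom}\,\partial h\to X^*$ by $H(x)=\eta^\ell$ whenever $\partial h(x)=P_\ell$. The map $G_C:\mathrm{dom}\,\partial(g+\delta_C)^*\to X$ is any map with $G_C(\xi)\in\partial(g+\delta_C)^*(\xi)$ for all $\xi$. DCA scheme 1: choose $x^0\in\mathrm{dom}(g+\delta_C)=(\mathrm{dom}\,g)\cap C$; for every $k\ge0$, if $x^k$ has been defined (and lies in the domain of $H$), take $\xi^k=H(x^k)$; if $\xi^k$ has been defined and $\xi^k\in\mathrm{dom}\,\partial(g+\delta_C)^*$, take $x^{k+1}=G_C(\xi^k)$. *)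

(* Defs.v *)
From HB Require Import structures.
From mathcomp Require Import all_boot all_order all_algebra.
From mathcomp Require Import all_classical all_reals all_analysis.

Set Implicit Arguments.
Unset Strict Implicit.
Unset Printing Implicit Defensive.

Import Order.TTheory GRing.Theory Num.Theory.
Import numFieldNormedType.Exports.

Local Open Scope classical_set_scope.
Local Open Scope ring_scope.

(* [tvsType R] is the library's class of locally convex topological vector
   spaces; it does not include the Hausdorff property. *)

Record topdual (R : realType) (Z : tvsType R) := Dual {
  dual_linear :> {linear Z -> R^o};
  dual_continuous : continuous dual_linear }.

Section generalized_polyhedral.
Context (R : realType).

Definition affine_set (Z : tvsType R) (L : set Z) :=
  forall y z (t : R), L y -> L z -> L ((1 - t) *: y + t *: z).

Definition generalized_polyhedral_set (Z : tvsType R) (D : set Z) :=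
  exists (L : set Z) (p : nat) (zs : 'I_p -> topdual Z) (alpha : 'I_p -> R),
    [/\ affine_set L, closed L &
        D = [set z | L z /\ forall k, zs k z <= alpha k]].

End generalized_polyhedral.

Section convex_analysis.
Context (R : realType) (X : tvsType R).
Implicit Types (phi : X -> \bar R) (psi : topdual X -> \bar R) (C : set X).
Local Open Scope ereal_scope.

Definition edom (T : Type) (phi : T -> \bar R) : set T :=
  [set x | phi x < +oo].

Definition epigraph phi : set (X * R^o) :=
  [set z | edom phi z.1 /\ phi z.1 <= z.2%:E].

Definition proper_efun phi := edom phi !=set0 /\ forall x, -oo < phi x.

Definition convex_efun phi := convex_set (epigraph phi).

Definition generalized_polyhedral_fun phi :=
  generalized_polyhedral_set (epigraph phi).

Definition indicator_efun C (x : X) : \bar R := if x \in C then 0 else +oo.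

Definition fenchel_conjugate phi (xs : topdual X) : \bar R :=
  ereal_sup [set (xs x)%:E - phi x | x in [set: X]].

Definition subdiff phi (x : X) : set (topdual X) :=
  [set xs | edom phi x /\ forall y, (xs (y - x)%R)%:E <= phi y - phi x].

(* The subdifferential of a function on the dual space, the latter carrying
   the weak* topology: its continuous linear functionals are the evaluations
   at the points of X, so that subgradients are points of X, and the pairing
   of [eta - xi] with [x] is [eta x - xi x]. *)
Definition dual_subdiff psi (xi : topdual X) : set X :=
  [set x | edom psi xi /\
     forall eta : topdual X, (eta x - xi x)%R%:E <= psi eta - psi xi].

Definition dom_subdiff phi : set X := [set x | subdiff phi x !=set0].

Definition dom_dual_subdiff psi : set (topdual X) :=
  [set xi | dual_subdiff psi xi !=set0].

(* Difference of functions with the convention +oo - +oo = +oo, which is that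
   of the dual addition of extended reals (the default one gives -oo). *)
Definition dc_fun (g h : X -> \bar R) : X -> \bar R :=
  fun x => (g x - h x)%dE.

(* A selection of the subdifferential of h on C `&` dom_subdiff h that depends
   only on the set [subdiff h x]. The values of H outside of that set are
   irrelevant. *)
Definition subdiff_selection (h : X -> \bar R) C (H : X -> topdual X) :=
  (forall x, (C `&` dom_subdiff h) x -> subdiff h x (H x)) /\
  (forall x y, (C `&` dom_subdiff h) x -> (C `&` dom_subdiff h) y ->
     subdiff h x = subdiff h y -> H x = H y).

(* The usual construction of such an H: list the finitely many values P_l of
   the subdifferential of h and pick one element eta_l in each of them. *)
Lemma subdiff_selection_of_list (h : X -> \bar R) C (H : X -> topdual X)
    (r : nat) (P : 'I_r -> set (topdual X)) (eta : 'I_r -> topdual X) :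
    (forall x, edom h x -> exists! l, subdiff h x = P l) ->
    (forall l, P l (eta l)) ->
    (forall x l, (C `&` dom_subdiff h) x -> subdiff h x = P l ->
       H x = eta l) ->
  subdiff_selection h C H.
Proof.
move=> hP Peta HE.
have lP x : (C `&` dom_subdiff h) x -> exists l, subdiff h x = P l.
  by move=> [_ [xs [/hP[l [? _]] _]]]; exists l.
split=> [x Cx|x y Cx Cy xy].
  by have [l xl] := lP x Cx; rewrite (HE _ _ Cx xl) xl.
by have [l xl] := lP x Cx; rewrite (HE _ _ Cx xl) (HE _ l Cy)// -xy.
Qed.

Definition dual_subdiff_selection psi (G : topdual X -> X) :=
  forall xi, dom_dual_subdiff psi xi -> dual_subdiff psi xi (G xi).

(* Infinite runs of the scheme. *)
Definition dca_scheme1 (g h : X -> \bar R) C (H : X -> topdual X)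
    (G : topdual X -> X) (x : nat -> X) (xi : nat -> topdual X) :=
  (edom g `&` C) (x 0%N) /\
  forall k : nat,
    [/\ (C `&` dom_subdiff h) (x k),
        xi k = H (x k),
        dom_dual_subdiff (fenchel_conjugate (g \+ indicator_efun C)) (xi k) &
        x k.+1 = G (xi k)].

End convex_analysis.

(* Main.v *)
Require Import Defs.
From HB Require Import structures.
From mathcomp Require Import all_boot all_order all_algebra.
From mathcomp Require Import all_classical all_reals all_analysis.
From mathcomp Require Import ring lra.

Import Order.TTheory GRing.Theory Num.Theory.
Import numFieldNormedType.Exports.

Local Open Scope classical_set_scope.
Local Open Scope ring_scope.

(** The iteration is deterministic: [x k.+1] is a function of [xi k], which is
a function of the set [subdiff h (x k)]. So both sequences become periodic as
soon as this set takes the same value at two different indices, and by the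
pigeonhole principle it is enough that [subdiff h] has finitely many values on
the domain of [h]. Indeed [subdiff h x] only depends on which of the finitely
many inequalities defining the epigraph of [h] are equalities at the point
[(x, h x)]: these determine in which directions one can leave that point and
stay in the epigraph, and, by convexity, being a subgradient is a condition on
these directions only ([finitely_many_subdiff]).

For the objective put [phi := g + indicator_efun C]. The inclusion of [xi k]
in [subdiff h (x k)] bounds [h (x k.+1) - h (x k)] from below by
[xi k (x k.+1 - x k)]. If moreover the Fenchel equality
[phi (x k.+1) + phi^* (xi k) = xi k (x k.+1)] holds, then the Fenchel
inequality at [x k] bounds [phi (x k.+1) - phi (x k)] from above by the same
number, so that [phi - h] does not increase along the sequence
([dca_descent]). Being nonincreasing and eventually periodic, it is eventually
constant.

The Fenchel equality is where the closedness and the convexity of [phi]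
matter: [x k.+1] is only known to be a subgradient of [phi^*] at [xi k], and
one must come back from [phi^*] to [phi] ([fenchel_equality_le]). This is done
by strictly separating a point from the epigraph of [phi] by a closed
hyperplane of [X * R] ([strict_separation]), which rests on a geometric form of
the Hahn-Banach theorem, proved by applying Zorn's lemma to the graphs of
partial linear functionals bounded by [1] on a given convex set
([geometric_hahn_banach]). *)

(** * The Hahn-Banach theorem for a convex absorbing set *)

Section hahn_banach.
Context (R : realType) (V : lmodType R) (K : set V).
Hypothesis K_convex : forall x y (t : R), 0 <= t <= 1 -> K x -> K y ->
  K (t *: x + (1 - t) *: y).
Hypothesis K_absorbing : forall v, exists2 t : R, 0 < t & K (t *: v).

(** A linear functional defined on a subspace of [V] is represented by its
graph, so that extension is inclusion and a chain is extended by its union.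
That the graph is single-valued is a consequence of the bound
([bounded_graph_functional]). *)
Definition bounded_graph (A : set (V * R^o)) :=
  [/\ forall (a : R) u v, A u -> A v -> A (a *: u + v) &
      forall u, A u -> K u.1 -> u.2 <= 1].

Lemma absorbing0 : K 0.
Proof. by have [t _] := K_absorbing 0; rewrite scaler0. Qed.

Lemma bounded_graph0 A : bounded_graph A -> A !=set0 -> A 0.
Proof.
move=> [Alin _] [u Au]; have := Alin (-1) u u Au Au.
by rewrite scaleN1r addNr.
Qed.

(** Otherwise the graph contains the vertical line through the origin, which
violates the bound at the point [0] of [K]. *)
Lemma bounded_graph_functional A v (r s : R) :
  bounded_graph A -> A (v, r) -> A (v, s) -> r = s.
Proof.
move=> Agraph Ar As; have [Alin Ale] := Agraph.
have A0 : A 0 by apply: bounded_graph0 => //; exists (v, r).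
apply/eqP; rewrite -subr_eq0; apply/negP => /negP rs0.
have Ars : A (0, r - s).
  have := Alin (-1) _ _ As Ar.
  rewrite [X in A X](_ : _ = (0, r - s))//.
  by congr pair => /=; rewrite scaleN1r addrC ?subrr.
have := Alin (2 / (r - s)) _ _ Ars A0; rewrite addr0 => /Ale /=.
rewrite scaler0 => /(_ absorbing0).
by rewrite /GRing.scale/= mulfVK// => ?; lra.
Qed.

(** A value [a] at [v] is admissible if it is at most [(1 - r) / t] whenever
[u + t v] is in [K] and at least [(r - 1) / s] whenever [u - s v] is in [K],
where [t] and [s] are positive and [r] is the value at [u]. The lower bounds
are at most the upper bounds by convexity of [K], so that the supremum of the
lower bounds is admissible. *)
Lemma bounded_graph_extend A v : bounded_graph A -> A 0 ->
  (forall r, ~ A (v, r)) ->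
  exists2 B, bounded_graph B & A `<` B.
Proof.
move=> Agraph A0 Av; have [Alin Ale] := Agraph.
pose lo := [set q : R | exists u s, [/\ A u, 0 < s, K (u.1 - s *: v) &
  q = (u.2 - 1) / s]].
have lo_le_hi q u t : lo q -> A u -> 0 < t -> K (u.1 + t *: v) ->
    q <= (1 - u.2) / t.
  move=> [u' [s [Au' s0 Ku' ->]]] Au t0 Ku.
  have st0 : 0 < s + t by rewrite addr_gt0.
  (* the convex combination of [u + t v] and [u' - s v] in which v cancels *)
  pose c := s / (s + t).
  have c01 : 0 <= c <= 1.
    apply/andP; split; first by apply: divr_ge0; apply: ltW.
    by rewrite ler_pdivrMr// mul1r lerDl ltW.
  have c'E : 1 - c = t / (s + t).
    by rewrite /c; field; rewrite gt_eqF.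
  have := K_convex _ _ _ c01 Ku Ku'.
  have -> : c *: (u.1 + t *: v) + (1 - c) *: (u'.1 - s *: v) =
      (c *: u + ((1 - c) *: u' + 0)).1.
    rewrite addr0 /= !scalerDr scalerN !scalerA c'E /c.
    by rewrite addrACA mulrAC [t / _ * s]mulrAC [t * s]mulrC subrr addr0.
  move=> /(Ale _ (Alin _ _ _ Au (Alin _ _ _ Au' A0))) /=.
  rewrite addr0 c'E /c /GRing.scale /= => le1.
  rewrite ler_pdivrMr// mulrAC ler_pdivlMr//.
  move: le1; rewrite mulrAC [t / _ * _]mulrAC -mulrDl ler_pdivrMr//.
  by nra.
have lo_ub : has_ubound lo.
  have [t t0 Kt] := K_absorbing v.
  exists ((1 - 0) / t) => q qlo.
  by apply: (lo_le_hi q 0 t qlo A0 t0); rewrite add0r.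
have [s0 s0_gt0 Ks0] := K_absorbing (- v).
have lo_neq0 : lo !=set0.
  exists ((0 - 1) / s0); exists 0, s0; split=> //=.
  by rewrite sub0r -scalerN.
pose a := sup lo.
exists [set u | exists t, A (u.1 - t *: v, u.2 - t * a)].
  split=> [c u u' [t At] [t' At']|[u r] [t /=]].
    exists (c * t + t') => /=.
    have := Alin c _ _ At At'; congr A; congr pair => /=.
      by rewrite scalerDr scalerN scalerA scalerDl opprD addrACA.
    by rewrite /GRing.scale/=; ring.
  move=> Au Ku.
  have [t0|t0|t0] := ltgtP t 0.
  - have : (r - t * a - 1) / (- t) <= a.
      apply: ub_le_sup => //; exists (u - t *: v, r - t * a), (- t).
      by rewrite oppr_gt0 /= scaleNr opprK subrK.
    by rewrite ler_pdivrMr ?oppr_gt0//; lra.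
  - have : a <= (1 - (r - t * a)) / t.
      apply: ge_sup => // q qlo.
      by apply: (lo_le_hi q (u - t *: v, r - t * a) t) => //=; rewrite subrK.
    by rewrite ler_pdivlMr//; lra.
  - by move: Au; rewrite t0 scale0r mul0r !subr0 => /Ale; apply.
split=> [u Au|].
  by exists 0; rewrite scale0r mul0r !subr0; case: u Au.
move=> /(_ (v, a)) BA; apply: (Av a); apply: BA.
by exists 1; rewrite scale1r mul1r !subrr.
Qed.

(** The functional extends [r w |-> r], which is bounded by [1] on [K] because
[K] is star-shaped at [0] and does not contain [w]. *)
Lemma geometric_hahn_banach (w : V) : ~ K w ->
  exists f : {linear V -> R^o}, f w = 1 /\ forall v, K v -> f v <= 1.
Proof.
move=> Kw.
pose line := [set u : V * R^o | u.1 = u.2 *: w].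
have line_graph : bounded_graph line.
  rewrite /line; split=> /= [a u u' -> ->|[_ r] /= -> Kr].
    by rewrite scalerDl scalerA.
  rewrite leNgt; apply/negP => r1; apply: Kw.
  have := K_convex (r *: w) 0 r^-1 _ Kr absorbing0.
  rewrite scaler0 addr0 scalerA mulVf ?scale1r; last by rewrite gt_eqF//; lra.
  by apply; rewrite invr_ge0 invf_le1; lra.
(* The empty set is a bounded graph, and it is the union of the empty chain:
   only nonempty graphs can be required to contain the line. *)
have [F FF totF|A [[Agraph Aline] Amax]] := @Zorn_bigcup _
    [set A | bounded_graph A /\ (A !=set0 -> line `<=` A)].
  split; last first.
    by move=> [u [B FB Bu]] z lz; exists B => //; apply: (FF B FB).2 => //; exists u.
  split=> [a u u' [B FB Bu] [B' FB' Bu']|u [B FB Bu]].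
    have [BB'|B'B] := totF _ _ FB FB'.
      by exists B' => //; apply: (FF _ FB').1.1 => //; exact: BB'.
    by exists B => //; apply: (FF _ FB).1.1 => //; exact: B'B.
  exact: (FF _ FB).1.2.
have line0 : line 0 by rewrite /line/= scale0r.
have An0 : A !=set0.
  apply/set0P/eqP => A0; apply: (Amax line); last first.
    by split=> // _; exact: subset_refl.
  by rewrite A0; split=> [|/(_ 0 line0)//]; exact: sub0set.
have lA := Aline An0.
have dom v : exists r, A (v, r).
  apply: contrapT => /forallNP Av.
  have [B Bgraph AB] := bounded_graph_extend A v Agraph (lA _ line0) Av.
  apply: (Amax B AB); split=> // _.
  by apply: subset_trans lA _; exact: AB.1.
have [f fA] := choice dom.
have [Alin Ale] := Agraph.
have f_linear : linear (f : V -> R^o).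
  move=> a u v; apply: (bounded_graph_functional A (a *: u + v)) => //.
  exact: Alin (fA u) (fA v).
pose fl : {linear V -> R^o} := HB.pack (f : V -> R^o)
  (GRing.isLinear.Build R V R^o *:%R f f_linear).
exists fl; split=> [|v Kv]; last exact: (Ale (v, f v)).
apply: (bounded_graph_functional A w (f w) 1 Agraph (fA w)).
by apply: lA; rewrite /line/= scale1r.
Qed.

End hahn_banach.

(** * Separation in a locally convex space *)

Lemma convex_setP (R : realType) (V : lmodType R) (D : set V) :
  convex_set D -> forall x y (t : R), 0 <= t <= 1 -> D x -> D y ->
  D (t *: x + (1 - t) *: y).
Proof.
move=> Dconv x y t /andP[t0 t1] Dx Dy.
have := Dconv x y (Itv01 t0 t1) (mem_set Dx) (mem_set Dy).
by rewrite inE.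
Qed.

(** A one-sided bound near [z] gives a two-sided bound on a symmetric
neighbourhood of [0], and a linear functional that is bounded near [0] is
continuous everywhere by homogeneity. *)
Lemma continuous_bounded_below (R : realType) (Z : tvsType R)
    (f : {linear Z -> R^o}) (z : Z) (m : R) (B : set Z) :
  nbhs z B -> (forall b, B b -> m <= f b) -> continuous f.
Proof.
move=> Bz mB /= x.
pose W := +%R (- z) @` B.
have W0 : nbhs (0 : Z) W by rewrite -(addNr z); exact: nbhsB.
pose M := `|f z - m| + 1.
have M0 : 0 < M by rewrite ltr_pwDr.
have WM u : (W `&` (-%R @` W)) u -> `|f u| < M.
  have WM1 u' : W u' -> - M < f u'.
    move=> [b Bb <-]; rewrite (raddfD f) (raddfN f).
    have := mB b Bb; rewrite /M; have := ler_norm (f z - m) => ? ?.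
    lra.
  move=> [Wu [u' Wu' uE]]; rewrite ltr_norml WM1//=.
  by rewrite -uE (raddfN f) ltrNl WM1.
move=> A /nbhs_ballP[e /= e0 eA].
have eM : e / M != 0 by rewrite gt_eqF// divr_gt0.
have WW0 : nbhs (0 : Z) (W `&` (-%R @` W)).
  by apply: filterI => //; exact: nbhs0N.
have := nbhsT x (nbhs0Z eM WW0).
apply: filterS => _ [_ [u Wu <-] <-]; apply: eA.
have fE (y v : Z) (a : R) : f (y + a *: v) = f y + a * f v.
  by rewrite addrC linearP addrC.
suff : `|f x - (f x + e / M * f u)| < e by rewrite -fE.
rewrite opprD addNKr normrN normrM.
rewrite gtr0_norm ?divr_gt0// mulrAC ltr_pdivrMr// ltr_pM2l//.
exact: WM.
Qed.

(** Take a convex open neighbourhood [B] of [z] disjoint from [E]. The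
functional is obtained from the set of the differences of points of [E] and of
[B], translated so that it absorbs every vector. It is bounded below on [B] by its
values on [E], whence its continuity, and it exceeds its value at [z] by a
positive amount somewhere in [B], whence the strict inequality. *)
Lemma strict_separation (R : realType) (Z : tvsType R) (E : set Z) (z : Z) :
  convex_set E -> closed E -> E !=set0 -> ~ E z ->
  exists f : topdual Z, exists2 e : R, 0 < e & forall y, E y -> f y <= f z - e.
Proof.
move=> Econv Ecl [e0 Ee0] Ez.
have [Bs Bsconv [Bsopen Bsz]] := @locally_convex R Z.
have /Bsz[B [BsB Bz] BE] : nbhs z (~` E).
  by apply: open_nbhs_nbhs; split=> //; rewrite openC.
have Bnbhs : nbhs z B by apply: open_nbhs_nbhs; split => //; exact: Bsopen.
have Bconv : convex_set B by apply: Bsconv; rewrite inE.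
pose w := z - e0.
pose K := [set u | exists y b, [/\ E y, B b & u = y - b + w]].
have Kconv x y (t : R) : 0 <= t <= 1 -> K x -> K y -> K (t *: x + (1 - t) *: y).
  move=> t01 [y1 [b1 [Ey1 Bb1 ->]]] [y2 [b2 [Ey2 Bb2 ->]]].
  exists (t *: y1 + (1 - t) *: y2), (t *: b1 + (1 - t) *: b2); split.
  - exact: convex_setP.
  - exact: convex_setP.
  - rewrite !(scalerDr _ _ w) addrACA -(scalerDl w) addrC subrKC scale1r.
    rewrite addrC; congr (_ + w).
    by rewrite !scalerDr addrACA !scalerN -opprD.
have Bray v : exists2 t : R, 0 < t & B (z - t *: v).
  have := nbhsB (- z) Bnbhs; rewrite addNr => /nbhs0N N0.
  have := @scale_continuous R Z (0, v) _; rewrite /= scale0r => /(_ _ N0).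
  move=> [[P Q] [/= /nbhs_ballP[r /= r0 rP] Qv] PQ].
  exists (r / 2); first by rewrite divr_gt0.
  have : P (r / 2) by apply: rP; rewrite /ball/= sub0r normrN gtr0_norm; lra.
  move=> Pr; have [_ [b Bb <-] /= bE] := PQ (r / 2, v) (conj Pr (nbhs_singleton Qv)).
  by rewrite -bE opprK addrA subrr add0r.
have Kabs v : exists2 t : R, 0 < t & K (t *: v).
  have [t t0 Bt] := Bray v; exists t => //.
  exists e0, (z - t *: v); split=> //.
  by rewrite opprB [e0 + _]addrC addrACA subrK subrr addr0.
have Kw : ~ K w.
  move=> [y [b [Ey Bb /eqP]]].
  rewrite -[X in X == _]add0r (inj_eq (addIr _)) eq_sym subr_eq0 => /eqP yb.
  by apply: (BE b Bb); rewrite -yb.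
have [f [fw fK]] := geometric_hahn_banach R Z K Kconv Kabs w Kw.
have fle y b : E y -> B b -> f y <= f b.
  move=> Ey Bb; have /fK : K (y - b + w) by exists y, b.
  have -> : f (y - b + w) = f y - f b + 1 by rewrite -fw linearD linearB.
  by lra.
have f_cont : continuous f.
  by apply: (@continuous_bounded_below _ _ f z (f e0) B) => // b; exact: fle.
have [t t0 Bt] := Bray w.
exists (Dual f_cont), t => // y Ey /=.
suff <- : f (z - t *: w) = f z - t by exact: fle.
by rewrite linearB linearZ /= fw /GRing.scale/= mulr1.
Qed.

(** * Continuous linear functionals *)

Lemma topdual_lincomb (R : realType) (X : tvsType R) (a b : R) (u v : topdual X) :
  exists w : topdual X, forall y, w y = a * u y + b * v y.
Proof.
pose f (y : X) : R^o := a *: u y + b *: v y.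
have f_linear : linear f.
  move=> c y z; rewrite /f (linearP u) (linearP v) /= !scalerDr !scalerA.
  by rewrite ![c * _]mulrC addrACA.
pose fl : {linear X -> R^o} := HB.pack f (GRing.isLinear.Build R X R^o *:%R f f_linear).
have f_cont : continuous fl.
  move=> y; apply: (@continuousD R R^o X (fun y => a *: u y) (fun y => b *: v y)).
    apply: (@continuousM R X (cst a) u); first exact: cst_continuous.
    exact: dual_continuous.
  apply: (@continuousM R X (cst b) v); first exact: cst_continuous.
  exact: dual_continuous.
by exists (Dual f_cont).
Qed.

Lemma topdual_prod (R : realType) (X : tvsType R) (f : topdual (X * R^o)%type) :
  exists (u : topdual X) (s : R), forall y t, f (y, t) = u y + t * s.
Proof.
pose i (y : X) : R^o := f (y, 0).
have i_linear : linear i.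
  move=> c y z; rewrite /i -linearP; congr (f (_, _)) => /=.
  by rewrite scaler0 addr0.
pose il : {linear X -> R^o} := HB.pack i (GRing.isLinear.Build R X R^o *:%R i i_linear).
have i_cont : continuous il.
  move=> y; apply: (@continuous_comp X (X * R^o)%type R^o (fun y => (y, 0)) f).
    move=> A [[P Q] [/= Py Q0] PQ]; apply: filterS Py => z Pz.
    by apply: (PQ (z, 0)); split=> //; exact: nbhs_singleton.
  exact: dual_continuous.
exists (Dual i_cont), (f (0, 1)) => y t.
have -> : (y, t) = (y, 0) + t *: (0, 1) :> X * R^o.
  by congr pair => /=; rewrite ?scaler0 ?addr0// add0r /GRing.scale/= mulr1.
by rewrite linearD linearZ.
Qed.

(** * Fenchel conjugates *)

Section conjugate.
Context (R : realType) (X : tvsType R) (phi : X -> \bar R).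
Hypothesis phi_proper : proper_efun phi.
Local Notation phis := (fenchel_conjugate phi).
Local Open Scope ereal_scope.

Lemma conjugate_le (eta : topdual X) (r : R) :
  (forall y t, epigraph phi (y, t) -> (eta y - t <= r)%R) -> phis eta <= r%:E.
Proof.
move=> le; apply: ub_ereal_sup => _ [y _ <-].
case E : (phi y) => [t| |].
- by rewrite -EFinB lee_fin; apply: le; rewrite /epigraph/edom/= E ltry.
- by rewrite addeNy leNye.
- by have := phi_proper.2 y; rewrite E.
Qed.

Lemma le_conjugate (eta : topdual X) y : (eta y)%:E - phi y <= phis eta.
Proof. by apply: ereal_sup_ubound; exists y. Qed.

Lemma proper_fin_num y : edom phi y -> phi y \is a fin_num.
Proof. by move=> y_dom; rewrite fin_numE -ltNye -ltey phi_proper.2. Qed.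

Lemma conjugate_fin_num (eta : topdual X) : edom phis eta ->
  phis eta \is a fin_num.
Proof.
move=> eta_dom; rewrite fin_numElt [_ < +oo]eta_dom andbT.
have [[y ydom] _] := phi_proper.
apply: lt_le_trans (le_conjugate eta y).
by have /fineK <- := proper_fin_num y ydom; rewrite -EFinB ltNyr.
Qed.

(** With [c := phi^* xi], the claim is that the point [(x, xi x - c)] lies in
the epigraph of [phi]. If not, a functional [(y, t) |-> u y + t s] separates
it strictly from the epigraph. Since the epigraph is unbounded upwards,
[s <= 0]. If [s = 0], the affine minorant [xi - c] of [phi] can be replaced by
one of slope [xi + u]; if [s < 0], by one of slope [- u / s]. In both cases the value of [phi^*] at the new functional
contradicts that [x] is a subgradient of [phi^*] at [xi]. *)
Lemma fenchel_equality_le (x : X) (xi : topdual X) :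
  convex_efun phi -> closed (epigraph phi) ->
  dual_subdiff phis xi x -> phi x + phis xi <= (xi x)%:E.
Proof.
move=> phi_convex phi_closed [xi_dom x_sub].
have [[y0 y0_dom] _] := phi_proper.
have /fineK y0E := proper_fin_num y0 y0_dom.
have /fineK := conjugate_fin_num xi xi_dom.
move: (fine (phis xi)) (fine (phi y0)) y0E => c t0 y0E cE.
have epi0 t : (t0 <= t)%R -> epigraph phi (y0, t).
  by move=> t0t; split=> //=; rewrite -y0E lee_fin.
(* A minorant of [phi] of slope [eta] and constant term [- r] cannot exceed
   the minorant [xi - c] at [x]. *)
have no_gap (eta : topdual X) (r : R) :
    (forall y t, epigraph phi (y, t) -> (eta y - t <= r)%R) ->
    (eta x - xi x + c <= r)%R.
  move=> /conjugate_le phir; rewrite -lerBrDr -lee_fin; apply: le_trans (x_sub eta) _.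
  by rewrite -cE EFinB leeB.
rewrite -cE -leeBrDr// -EFinB leNgt; apply/negP => gap.
have [|f [e e0 fe]] := strict_separation R _ _ (x, xi x - c)%R phi_convex phi_closed
    (ex_intro _ (y0, t0) (epi0 t0 (lexx _))).
  by move=> [_ /=]; rewrite leNgt gap.
have [u [s fE]] := topdual_prod R X f.
have {}fe y t : epigraph phi (y, t) ->
    (u y + t * s <= u x + (xi x - c) * s - e)%R.
  by move=> /fe; rewrite !fE.
have s_le0 : (s <= 0)%R.
  rewrite leNgt; apply/negP => s0.
  have := fe y0 t0 (epi0 _ (lexx _)).
  set M := (u x + _ - e)%R in fe * => M0.
  pose d := (M - (u y0 + t0 * s) + 1)%R.
  have /epi0/fe : (t0 <= t0 + d / s)%R.
    by rewrite lerDl divr_ge0 ?(ltW s0)//; rewrite /d; lra.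
  by rewrite mulrDl divfK ?gt_eqF// /d; lra.
have [s0|s0] := eqVneq s 0%R.
  have [eta etaE] := topdual_lincomb R X 1 1 xi u.
  suff : (eta x - xi x + c <= c + u x - e)%R by rewrite etaE; lra.
  apply: no_gap => y t yt; rewrite etaE.
  have := fe _ _ yt; rewrite s0 => ?.
  have := le_conjugate xi y; rewrite -cE.
  have /fineK <- := proper_fin_num y yt.1.
  have := yt.2 => /=.
  have /fineK <- := proper_fin_num y yt.1.
  by rewrite -EFinB !lee_fin; lra.
have {s0}s_lt0 : (s < 0)%R by rewrite lt_neqAle s0.
have [eta etaE] := topdual_lincomb R X (- s^-1) 0 u u.
have s'0 : (0 < - s^-1)%R by rewrite oppr_gt0 invr_lt0.
suff : (eta x - xi x + c <= eta x - (xi x - c) - e * - s^-1)%R.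
  by have := mulr_gt0 e0 s'0; lra.
apply: no_gap => y t /fe; rewrite !etaE !mul0r !addr0.
move=> /(ler_wpM2l (ltW s'0)).
rewrite mulrBr !mulrDr ![(- s^-1 * (_ * s))%R]mulrCA.
have -> : (- s^-1 * s = -1)%R by rewrite mulNr mulVf// lt_eqF.
by lra.
Qed.

End conjugate.

(** * Epigraphs *)

Section epigraph.
Context (R : realType) (X : tvsType R).
Local Open Scope ereal_scope.

Lemma closed_epigraph (phi : X -> \bar R) :
  lower_semicontinuous phi -> closed (epigraph phi).
Proof.
move=> phi_lsc; rewrite -openC openE => -[x c] /= epixc.
have cphi : c%:E < phi x.
  rewrite ltNge; apply/negP => phic; apply: epixc; split=> //=.
  exact: le_lt_trans phic (ltry _).
have [a ca aphi] : exists2 a, (c < a)%R & a%:E < phi x.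
  move: cphi; case: (phi x) => [r|_|//]; last by exists (c + 1)%R; rewrite ?ltry//; lra.
  by rewrite lte_fin => cr; exists ((c + r) / 2)%R; rewrite ?lte_fin; lra.
have [V Vx Va] := phi_lsc _ _ aphi.
exists (V, [set t : R^o | (t < a)%R]) => [|[y t] /= [Vy ta] [_ /=]].
  split => //=; exact: lt_nbhsl.
by rewrite leNgt (lt_trans _ (Va _ Vy)).
Qed.

Lemma epigraph_add_indicator (g : X -> \bar R) (C : set X) :
  (forall x, -oo < g x) ->
  epigraph (g \+ indicator_efun C) = epigraph g `&` (fst @^-1` C).
Proof.
move=> gNy; apply/seteqP; split=> -[x c] /=; rewrite /epigraph/edom/indicator_efun/=.
  case: ifPn => [xC|_]; first by rewrite adde0 => -[]; split=> //; exact: set_mem.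
  by rewrite addey ?gt_eqF ?gNy// => -[].
by move=> [gx Cx]; rewrite mem_set// adde0.
Qed.

End epigraph.

(** * The subdifferential of a polyhedral function *)

(** The common step size is the inverse of [1] plus the sum of all the ratios
that it has to compensate. *)
Lemma finite_positive_step (R : realType) (I : finType) (J : pred I)
    (c d : I -> R) : (forall k, J k -> 0 < c k) ->
  exists2 e : R, 0 < e & forall k, J k -> e * d k <= c k.
Proof.
move=> c0; pose S := \sum_(k | J k) `|d k| / c k.
have term_ge0 k : J k -> 0 <= `|d k| / c k by move=> /c0/ltW ck; rewrite divr_ge0.
have S0 : 0 <= S by exact: sumr_ge0.
exists (1 + S)^-1 => [|k Jk]; first by rewrite invr_gt0; lra.
rewrite mulrC ler_pdivrMr; last by lra.
apply: (le_trans (ler_norm _)).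
have : `|d k| / c k <= S.
  by rewrite /S (bigD1 k)//= lerDl sumr_ge0// => i /andP[/term_ge0].
by have := c0 _ Jk => ck; rewrite ler_pdivrMr//; nra.
Qed.

(** The point is the midpoint of [x + 2 e (y - x)] and [x - 2 e (z - x)], each
on a line through two points of [L]. *)
Lemma affine_set_add_sub (R : realType) (Z : tvsType R) (L : set Z)
    (x y z : Z) (e : R) : affine_set L -> L x -> L y -> L z ->
  L (x + e *: (y - z)).
Proof.
move=> Laff Lx Ly Lz.
have := Laff _ _ (2^-1) (Laff _ _ (2 * e) Lx Ly) (Laff _ _ (- (2 * e)) Lx Lz).
congr L; rewrite opprK; have -> : 1 - 2^-1 = 2^-1 :> R by lra.
rewrite -scalerDr addrACA -scalerDl scaleNr -scalerBr scalerDr !scalerA.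
have -> : 2^-1 * (1 - 2 * e + (1 + 2 * e)) = 1 by lra.
by have -> : 2^-1 * (2 * e) = e; [lra|rewrite scale1r].
Qed.

Section polyhedral.
Context (R : realType) (X : tvsType R) (h : X -> \bar R).
Hypothesis h_proper : proper_efun h.

Lemma graph_epigraph x : edom h x -> epigraph h (x, fine (h x)).
Proof. by move=> xdom; split=> //=; rewrite fineK ?proper_fin_num. Qed.

(** A subgradient at [x] is a functional whose graph lies below the epigraph in
all the directions that remain in the epigraph for a short time from
[(x, h x)]; the hypothesis says that these include all the directions pointing
from [(x', h x')] into the epigraph. *)
Lemma subdiff_local x x' :
  edom h x -> edom h x' ->
  (forall z, epigraph h z -> exists2 e : R, 0 < e &
     epigraph h ((x, fine (h x)) + e *: (z - (x', fine (h x'))))) ->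
  subdiff h x `<=` subdiff h x'.
Proof.
move=> xdom x'dom step xs [_ xs_sub]; split=> // y.
have /fineK hx := proper_fin_num _ _ _ h_proper x xdom.
have /fineK hx' := proper_fin_num _ _ _ h_proper x' x'dom.
rewrite -hx'; case hy : (h y) => [t| |]; last 2 first.
- by rewrite addye// leey.
- by have := h_proper.2 y; rewrite hy.
have [|e e0 [_ /=]] := step (y, t).
  by split; rewrite /edom/= hy// ltry.
set w := (X in h X) => hw.
have : ((xs (e *: (y - x')))%:E <= (e * (t - fine (h x')))%:E)%E.
  have := xs_sub w; rewrite -hx /w addrAC subrr add0r => /le_trans; apply.
  by apply: le_trans (leeB hw (lexx _)) _; rewrite -EFinB lee_fin addrAC subrr add0r.
by rewrite linearZ /= lee_fin -EFinB lee_fin ler_pM2l.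
Qed.

(** [I x] is the set of the constraints that are active at [(x, h x)]. If it
equals [I x'], a direction pointing from [(x', h x')] into the epigraph does
not increase the constraints active at [(x, h x)], and a small step preserves
the others. *)
Lemma finitely_many_subdiff : generalized_polyhedral_fun h ->
  exists (n : nat) (I : X -> {set 'I_n}), forall x x', edom h x -> edom h x' ->
    I x = I x' -> subdiff h x = subdiff h x'.
Proof.
move=> [L [n [zs [alpha [Laff _ epiE]]]]].
pose P x : X * R^o := (x, fine (h x)).
exists n, (fun x => [set k | zs k (P x) == alpha k]%SET).
suff sub x x' : edom h x -> edom h x' ->
    [set k | zs k (P x) == alpha k]%SET = [set k | zs k (P x') == alpha k]%SET ->
    subdiff h x `<=` subdiff h x'.
  by move=> x x' dx dx' II; apply/seteqP; split; apply: sub.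
move=> dx dx' II; apply: subdiff_local => // z.
have := graph_epigraph _ dx; have := graph_epigraph _ dx'.
rewrite epiE => -[Lx' ax'] [Lx ax] [Lz az].
have [k|e e0 small] := finite_positive_step R 'I_n (fun k => zs k (P x) != alpha k)
    (fun k => alpha k - zs k (P x)) (fun k => zs k (z - P x')).
  by move=> neq; rewrite subr_gt0 lt_neqAle neq ax.
exists e => //; split=> [|k]; first exact: affine_set_add_sub.
rewrite linearD linearZ /= -lerBrDl.
have [xk|/small//] := eqVneq (zs k (P x)) (alpha k).
have : k \in [set k | zs k (P x') == alpha k]%SET by rewrite -II inE xk.
rewrite inE => /eqP x'k.
rewrite -/(P x) xk subrr linearB /= -/(P x') x'k.
by apply: mulr_ge0_le0; [exact: ltW|rewrite subr_le0 az].
Qed.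
End polyhedral.

(** * Monotonicity and periodicity *)

Lemma dca_descent (R : realType) (X : tvsType R) (phi h : X -> \bar R)
    (x y : X) (xi : topdual X) :
  proper_efun phi -> convex_efun phi -> closed (epigraph phi) ->
  proper_efun h ->
  edom phi x -> subdiff h x xi -> edom h y ->
  dual_subdiff (fenchel_conjugate phi) xi y ->
  edom phi y /\ fine (phi y) - fine (h y) <= fine (phi x) - fine (h x).
Proof.
move=> phi_proper phi_convex phi_closed h_proper phix [hx xi_sub] hy y_sub.
have := fenchel_equality_le _ _ _ phi_proper _ _ phi_convex phi_closed y_sub.
have /fineK <- := conjugate_fin_num _ _ _ phi_proper _ y_sub.1.
rewrite -leeBrDr// => phiy_le.
have phiy : edom phi y by apply: le_lt_trans phiy_le _; rewrite -EFinB ltry.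
split=> //; move: phiy_le.
have := le_conjugate _ _ phi xi x.
have /fineK <- := conjugate_fin_num _ _ _ phi_proper _ y_sub.1.
have := xi_sub y.
have /fineK <- := proper_fin_num _ _ _ phi_proper _ phiy.
have /fineK <- := proper_fin_num _ _ _ phi_proper _ phix.
have /fineK <- := proper_fin_num _ _ _ h_proper _ hx.
have /fineK <- := proper_fin_num _ _ _ h_proper _ hy.
rewrite -!EFinB !lee_fin linearB /=.
lra.
Qed.

Lemma pigeonhole_nat (T : finType) (f : nat -> T) :
  exists i j : nat, (i < j)%N /\ f i = f j.
Proof.
have : ~~ injectiveb (fun i : 'I_#|T|.+1 => f i).
  by apply/negP => /injectiveP/leq_card; rewrite card_ord ltnn.
move=> /injectivePn[i [j ij fij]].
have [lt_ij|lt_ji|/val_inj eq_ij] := ltngtP i j.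
- by exists i, j.
- by exists j, i.
- by rewrite eq_ij eqxx in ij.
Qed.

Lemma periodic_nonincreasing_constant (R : realType) (F : nat -> R) (n p : nat) :
  (0 < p)%N -> (forall k, F k.+1 <= F k) ->
  (forall k, (n <= k)%N -> F (k + p)%N = F k) ->
  forall k, (n <= k)%N -> F k = F n.
Proof.
move=> p0 /nonincreasing_seqP F_noninc F_per k nk.
have F_perM m : F (n + m * p)%N = F n.
  elim: m => [|m IH]; first by rewrite addn0.
  by rewrite mulSnr addnA F_per ?leq_addr.
apply/eqP; rewrite eq_le F_noninc//= -(F_perM k); apply: F_noninc.
by rewrite (leq_trans (leq_pmulr k p0))// leq_addl.
Qed.

Theorem theorem5p4 (R : realType) (X : tvsType R) (X_hausdorff : hausdorff_space X)
    (g h : X -> \bar R) (C : set X)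
    (g_lsc : lower_semicontinuous g) (g_proper : proper_efun g)
    (g_convex : convex_efun g)
    (h_proper : proper_efun h) (h_polyhedral : generalized_polyhedral_fun h)
    (C_nonempty : C !=set0) (C_closed : closed C) (C_convex : convex_set C)
    (gC : (edom g `&` C) !=set0)
    (H : X -> topdual X) (H_selection : subdiff_selection h C H)
    (G : topdual X -> X)
    (G_selection : dual_subdiff_selection (fenchel_conjugate (g \+ indicator_efun C)%E) G)
    (x : nat -> X) (xi : nat -> topdual X)
    (x_xi_dca : dca_scheme1 g h C H G x xi) :
  exists kbar p : nat,
    [/\ (1 <= p)%N,
        forall k, (kbar <= k)%N -> x (k + p)%N = x k /\ xi (k + p)%N = xi k &
        forall k, (kbar <= k)%N -> dc_fun g h (x k) = dc_fun g h (x kbar)].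
Proof.
have [[x0_dom x0C] step] := x_xi_dca.
have xC k : (C `&` dom_subdiff h) (x k) by have [] := step k.
have xiE k : xi k = H (x k) by have [] := step k.
have xSE k : x k.+1 = G (xi k) by have [] := step k.
have h_dom k : edom h (x k) by have [_ [xs []]] := xC k.
have [n [I IP]] := finitely_many_subdiff _ _ _ h_proper h_polyhedral.
have [i [j [lt_ij Iij]]] := pigeonhole_nat _ (I \o x).
have xiij : xi i = xi j.
  by rewrite !xiE; apply: H_selection.2 => //; exact: IP.
have x_per k : (i.+1 <= k)%N -> x (k + (j - i))%N = x k.
  elim: k => // k IH; rewrite ltnS leq_eqVlt => /predU1P[<-|/IH xk].
    by rewrite addSn subnKC ?(ltnW lt_ij)// !xSE xiij.
  by rewrite addSn !xSE !xiE xk.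
pose phi := (g \+ indicator_efun C)%E.
have phi_epi := epigraph_add_indicator _ _ g C g_proper.2.
have phiE y : C y -> phi y = g y.
  by move=> Cy; rewrite /phi /indicator_efun /= mem_set// adde0.
have phi_proper : proper_efun phi.
  split; first by have [y [gy Cy]] := gC; exists y; rewrite /edom/= phiE.
  move=> y; rewrite /phi/indicator_efun/=; case: ifPn => _.
    by rewrite adde0 g_proper.2.
  by rewrite addey ?ltNyy// gt_eqF// g_proper.2.
have phi_convex : convex_efun phi.
  rewrite /convex_efun phi_epi => u v t /[!inE] -[gu Cu] [gv Cv]; split.
    by apply: set_mem; apply: g_convex; exact: mem_set.
  by apply: set_mem; apply: (C_convex u.1 v.1 t); exact: mem_set.
have phi_closed : closed (epigraph phi).
  rewrite phi_epi; apply: closedI; first exact: closed_epigraph.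
  by apply: closed_comp => // z _; exact: cvg_fst.
have descent k : edom phi (x k) -> edom phi (x k.+1) /\
    fine (phi (x k.+1)) - fine (h (x k.+1)) <= fine (phi (x k)) - fine (h (x k)).
  move=> phik; apply: (dca_descent _ _ _ _ _ _ (xi k)) => //.
    by rewrite xiE; exact: H_selection.1.
  by rewrite xSE; apply: G_selection; have [] := step k.
have phi_dom k : edom phi (x k).
  elim: k => [|k /descent[]//]; by rewrite /edom/= phiE.
exists i.+1, (j - i)%N; split.
- by rewrite subn_gt0.
- by move=> k ik; rewrite !xiE x_per.
pose F k := fine (phi (x k)) - fine (h (x k)).
have fF k : dc_fun g h (x k) = (F k)%:E.
  rewrite /dc_fun -phiE; last exact: (xC k).1.
  have /fineK <- := proper_fin_num _ _ _ phi_proper _ (phi_dom k).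
  by have /fineK <- := proper_fin_num _ _ _ h_proper _ (h_dom k).
move=> k ik; rewrite !fF; congr EFin.
apply: (periodic_nonincreasing_constant R F _ (j - i)%N) => // [|m|m im].
- by rewrite subn_gt0.
- exact: (descent m (phi_dom m)).2.
- by rewrite /F x_per.
Qed.
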